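(* For a strong fixed-point context $\Upsilon_{A,\overline{c_0}}$ with $\overline{c_0}\subseteq\overline{c}$: (1) $\mathsf{N}\,\overline{c},c_1.\,\Upsilon_{A,\overline{c_0}}\vdash (a\ c_1)\curlywedge t$ is derivable iff $[\Upsilon_{A,\overline{c_0}}]_{\#}\vdash a\# t$ is derivable; (2) $\mathsf{N}\,\overline{c}.\,\Upsilon_{A,\overline{c_0}}\vdash s\approx_\alpha t$ is derivable iff $[\Upsilon_{A,\overline{c_0}}]_{\#},\ \overline{\overline{c}\#\mathrm{var}(s,t)}\vdash s\approx t$ is derivable.
   Context: $\mathsf{N}$ denotes Pitts' ''new'' quantifier. A strong fixed-point context $\Upsilon_{A,C}$ is a finite set of primitive constraints $\mathsf{N}c.(a\ c)\curlywedge X$ with $a\in A$, $c\in C$ ($A$, $C$ disjoint sets of atoms), where $\pi\curlywedge t$ means ''$\pi$ fixes $t$''. The left-hand judgements are strong judgements derived with the rules: $\pi\curlywedge a$ if $\pi(a)=a$; $\pi\curlywedge\rho\cdot X$ if $\mathrm{dom}(\pi^{\rho^{-1}})\setminus\overline{c}\subseteq\mathrm{dom}(\mathrm{perm}(\Upsilon|_X))$ (where $\mathrm{dom}(\mathrm{perm}(\Upsilon|_X))=\{a\mid(a\ c)\curlywedge X\in\Upsilon\}$); $\pi\curlywedge\mathtt{f}(\dots)$ componentwise; $\pi\curlywedge[a]t$ from $\mathsf{N}\,\overline{c},c_1.\Upsilon\vdash\pi\curlywedge(a\ c_1)\cdot t$; $a\approx_\alpha a$; $\pi\cdot X\approx_\alpha\rho\cdot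 X$ if $\mathrm{dom}(\rho^{-1}\circ\pi)\setminus\overline{c}\subseteq\mathrm{dom}(\mathrm{perm}(\Upsilon|_X))$; congruences; and $[a]s\approx_\alpha[b]t$ from $s\approx_\alpha(a\ b)\cdot t$ and $\mathsf{N}\,\overline{c},c_1.\Upsilon\vdash(a\ c_1)\curlywedge t$. The right-hand judgements use freshness constraints $a\#t$ and $\alpha$-equality $s\approx t$ with freshness contexts (sets of $a\#X$), derived by the standard nominal rules: $a\#b$; $a\#\pi\cdot X$ if $\pi^{-1}(a)\#X$ is in the context; $a\#[a]t$; $a\#[b]t$ from $a\#t$; $a\#\mathtt{f}(t_1,\dots,t_n)$ from all $a\#t_i$; $a\approx a$; $\pi\cdot X\approx\pi'\cdot X$ if $\mathrm{ds}(\pi,\pi')\#X$ is in the context, where $\mathrm{ds}(\pi,\pi')=\{a\mid\pi(a)\neq\pi'(a)\}$; congruences; and $[a]s\approx[b]t$ from $s\approx(a\ b)\cdot t$ and $a\#t$. The translation $[\cdot]_{\#}$ maps each $\mathsf{N}c.(a\ c)\curlywedge X$ to $a\#X$, extended to contexts elementwise. $\overline{\overline{c}\#\mathrm{var}(s,t)}$ denotes the set $\{c\#X\mid c\in\overline{c},\ X \text{ a variable occurring in } s \text{ or } t\}$.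
   Formalization: Part (1) is stated for names c̄ that do not occur in a or t (and c1 new for all of them); without this it fails, e.g. for the empty context, c̄ = {c}, a = b, t = (b c)·X, where the left side is derivable but b # t is not. *)

(* Defs.v *)
From mathcomp Require Import all_boot finmap.
Set Implicit Arguments.
Unset Strict Implicit.
Unset Printing Implicit Defensive.

Local Open Scope fset_scope.

Section Perm.
Variable atom : choiceType.

(* The default value of an [fsfun] from a type to itself is the identity, so
   [finsupp p] is the domain {a | p a <> a} of the permutation p, and Leibniz
   equality of permutations is extensional. *)
Record fperm := FPerm {
  fperm_val :> {fsfun atom -> atom};
  _ : fsinjectiveb fperm_val }.

Implicit Types (p q : fperm) (a b c x : atom).

Lemma fperm_injective p : injective p.
Proof. by case: p => f /= /fsinjectiveP. Qed.

Lemma fperm_dom_image p : p @` finsupp p = finsupp p.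
Proof. by case: p => f /= /imfset_eq_fsinjectiveP. Qed.

Lemma fpcomp_subproof p q : fsinjectiveb (fsfun_comp p q).
Proof.
apply/fsinjectiveP => a b; rewrite !fscompE /=.
by move=> /fperm_injective /fperm_injective.
Qed.

Definition fpcomp p q : fperm := FPerm (fpcomp_subproof p q).

Lemma fpcompE p q a : fpcomp p q a = p (q a).
Proof. exact: fscompE. Qed.

Definition fpinv_fun p : {fsfun atom -> atom} :=
  [fsfun a in finsupp p =>
     oapp (fun y : finsupp p => val y) a [pick y : finsupp p | p (val y) == a]].

Lemma fpinv_funK p a : p (fpinv_fun p a) = a.
Proof.
rewrite /fpinv_fun fsfun_fun; case: ifP => [|/negbT ap]; last exact: fsfun_dflt.
rewrite -{1}fperm_dom_image => /imfsetP[y /= yp ->].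
by case: pickP => [z /eqP //|/(_ (Sub y yp))/=]; rewrite eqxx.
Qed.

Lemma fpinv_subproof p : fsinjectiveb (fpinv_fun p).
Proof. by apply/fsinjectiveP; apply: (can_inj (g := p)) => a; apply: fpinv_funK. Qed.

Definition fpinv p : fperm := FPerm (fpinv_subproof p).

Lemma fpinvKV p a : p (fpinv p a) = a.
Proof. exact: fpinv_funK. Qed.

Lemma fpinvK p a : fpinv p (p a) = a.
Proof. by apply: (@fperm_injective p); rewrite fpinvKV. Qed.

Definition swap_fun a b : {fsfun atom -> atom} :=
  [fsfun x in [fset a; b] => if x == a then b else a].

Lemma swap_funE a b x :
  swap_fun a b x = if x == a then b else if x == b then a else x.
Proof. by rewrite /swap_fun fsfun_fun !inE; case: eqP => //=; case: eqP. Qed.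

Lemma swap_subproof a b : fsinjectiveb (swap_fun a b).
Proof.
apply/fsinjectiveP; apply: (can_inj (g := swap_fun a b)) => x; rewrite !swap_funE.
have [->|xa] := eqVneq x a; first by rewrite eqxx; case: eqP.
have [->|xb] := eqVneq x b; first by rewrite eqxx.
by rewrite (negbTE xa) (negbTE xb).
Qed.

Definition swap a b : fperm := FPerm (swap_subproof a b).

Lemma swapE a b x : swap a b x = if x == a then b else if x == b then a else x.
Proof. exact: swap_funE. Qed.

End Perm.

Section Syntax.
Variables (atom var : choiceType) (op : Type) (ar : op -> nat).

Inductive term : Type :=
| Atom of atom
| Susp of fperm atom & var
| Abs of atom & term
| App (f : op) of ('I_(ar f) -> term).

Fixpoint pact (p : fperm atom) (t : term) : term :=
  match t with
  | Atom a => Atom (p a)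
  | Susp q X => Susp (fpcomp p q) X
  | Abs a u => Abs (p a) (pact p u)
  | App f us => App (fun i => pact p (us i))
  end.

Implicit Types (a b c : atom) (X : var) (p q : fperm atom) (s t u : term).

(* All atoms occurring in a term, free or abstracted. *)
Fixpoint atoms (t : term) : {fset atom} :=
  match t with
  | Atom a => [fset a]
  | Susp q X => finsupp q
  | Abs a u => a |` atoms u
  | App f us => \big[@fsetU _/fset0]_(i < ar f) atoms (us i)
  end.

Fixpoint vars (t : term) : {fset var} :=
  match t with
  | Atom a => fset0
  | Susp q X => [fset X]
  | Abs a u => vars u
  | App f us => \big[@fsetU _/fset0]_(i < ar f) vars (us i)
  end.

Implicit Types (cs A C : {fset atom}).

(* The triple (a, c, X) stands for the constraint "N c. (a c) fixes X". *)
Definition fix_ctx : Type := {fset atom * atom * var}.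

(* The pair (a, X) stands for the constraint "a # X". *)
Definition fresh_ctx : Type := {fset atom * var}.

Definition strong_fix_ctx (A C : {fset atom}) (Y : fix_ctx) : Prop :=
  [disjoint A & C] /\ forall a c X, (a, c, X) \in Y -> a \in A /\ c \in C.

Definition dom_perm (Y : fix_ctx) (X : var) : {fset atom} :=
  [fset u.1.1 | u in Y & u.2 == X].

Definition ctx_atoms (Y : fix_ctx) : {fset atom} :=
  [fset u.1.1 | u in Y] `|` [fset u.1.2 | u in Y].

Definition to_fresh (Y : fix_ctx) : fresh_ctx := [fset (u.1.1, u.2) | u in Y].

(* [sfix Y cs p t] is the strong judgement "N cs. Y |- p fixes t". An atom
   newly added to cs must be new for every component of the conclusion. *)
Inductive sfix (Y : fix_ctx) : {fset atom} -> fperm atom -> term -> Prop :=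
| sfix_atom cs p a : p a = a -> sfix Y cs p (Atom a)
| sfix_susp cs p q X :
    finsupp (fpcomp (fpinv q) (fpcomp p q)) `\` cs `<=` dom_perm Y X ->
    sfix Y cs p (Susp q X)
| sfix_app cs p f us :
    (forall i, sfix Y cs p (us i)) -> sfix Y cs p (@App f us)
| sfix_abs cs c1 p a t :
    c1 \notin cs `|` ctx_atoms Y `|` finsupp p `|` (a |` atoms t) ->
    sfix Y (c1 |` cs) p (pact (swap a c1) t) ->
    sfix Y cs p (Abs a t).

(* [saeq Y cs s t] is the strong judgement "N cs. Y |- s alpha-equals t". *)
Inductive saeq (Y : fix_ctx) (cs : {fset atom}) : term -> term -> Prop :=
| saeq_atom a : saeq Y cs (Atom a) (Atom a)
| saeq_susp p q X :
    finsupp (fpcomp (fpinv q) p) `\` cs `<=` dom_perm Y X ->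
    saeq Y cs (Susp p X) (Susp q X)
| saeq_app f us vs :
    (forall i, saeq Y cs (us i) (vs i)) -> saeq Y cs (@App f us) (@App f vs)
| saeq_abs a s t : saeq Y cs s t -> saeq Y cs (Abs a s) (Abs a t)
| saeq_abs_neq a b c1 s t :
    a <> b ->
    saeq Y cs s (pact (swap a b) t) ->
    c1 \notin cs `|` ctx_atoms Y `|` (a |` atoms s) `|` (b |` atoms t) ->
    sfix Y (c1 |` cs) (swap a c1) t ->
    saeq Y cs (Abs a s) (Abs b t).

Inductive fresh (D : fresh_ctx) (a : atom) : term -> Prop :=
| fresh_atom b : a <> b -> fresh D a (Atom b)
| fresh_susp p X : (fpinv p a, X) \in D -> fresh D a (Susp p X)
| fresh_abs t : fresh D a (Abs a t)
| fresh_abs_neq b t : a <> b -> fresh D a t -> fresh D a (Abs b t)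
| fresh_app f us : (forall i, fresh D a (us i)) -> fresh D a (@App f us).

Inductive aeq (D : fresh_ctx) : term -> term -> Prop :=
| aeq_atom a : aeq D (Atom a) (Atom a)
| aeq_susp p q X :
    (forall a, p a <> q a -> (a, X) \in D) -> aeq D (Susp p X) (Susp q X)
| aeq_app f us vs :
    (forall i, aeq D (us i) (vs i)) -> aeq D (@App f us) (@App f vs)
| aeq_abs a s t : aeq D s t -> aeq D (Abs a s) (Abs a t)
| aeq_abs_neq a b s t :
    a <> b -> aeq D s (pact (swap a b) t) -> fresh D a t ->
    aeq D (Abs a s) (Abs b t).

End Syntax.

(* Main.v *)
Require Import Defs.
From mathcomp Require Import all_boot finmap.
Set Implicit Arguments.
Unset Strict Implicit.
Unset Printing Implicit Defensive.

Local Open Scope fset_scope.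

(** Call an atom [b] admissible for [X] under [(Y, cs)] when [b # X] is in the
    translation of [Y] or [b] is one of the new atoms [cs].  The key fact is that
    [N cs. Y |- p fixes t] holds iff every atom moved by [p] is fresh for [t] with
    respect to admissibility.  Under an abstraction the fixed-point rule adds a
    new [c1] to [cs] and renames the bound atom to [c1]; renaming makes the
    condition on the bound atom vacuous, and adding [c1] changes nothing for the
    other atoms, since [c1] does not occur in the term.  Both parts follow:
    admissibility can only differ from membership in the freshness context at
    atoms of [cs], which part (1) keeps apart from the term and which part (2)
    puts into the context. *)

(** * Freshness relative to an arbitrary predicate on atoms and variables *)

Section Freshness.
Variables (atom var : choiceType) (op : Type) (ar : op -> nat).
Local Notation term := (term atom var ar).
Implicit Types (D E : atom -> pred var) (a b c x : atom) (p q : fperm atom) (t : term).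

Lemma fpinv_neq p a b : (fpinv p a != b) = (a != p b).
Proof. by rewrite -(inj_eq (@fperm_injective _ p)) fpinvKV. Qed.

Lemma fpinv_out p a : a \notin finsupp p -> fpinv p a = a.
Proof. by move=> ap; rewrite -[in LHS](fsfun_dflt ap) fpinvK. Qed.

Lemma fpinv_comp p q a : fpinv (fpcomp p q) a = fpinv q (fpinv p a).
Proof.
by apply: (@fperm_injective _ (fpcomp p q)); rewrite fpinvKV fpcompE !fpinvKV.
Qed.

Lemma fpinv_swap a b x : fpinv (swap a b) x = swap a b x.
Proof.
apply: (@fperm_injective _ (swap a b)); rewrite fpinvKV !swapE.
have [->|xa] := eqVneq x a; first by rewrite eqxx; case: eqVneq.
by case: (eqVneq x b) => [->|/negbTE->]; rewrite ?eqxx ?(negbTE xa).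
Qed.

Lemma vars_pact p t : vars (pact p t) = vars t.
Proof. by elim: t => //= f us IH; apply: eq_bigr. Qed.

Lemma atoms_arg f (us : 'I_(ar f) -> term) i : atoms (us i) `<=` atoms (App us).
Proof. by rewrite /= (bigD1 i) //= fsubsetUl. Qed.

Lemma vars_arg f (us : 'I_(ar f) -> term) i : vars (us i) `<=` vars (App us).
Proof. by rewrite /= (bigD1 i) //= fsubsetUl. Qed.

Fixpoint depth t : nat :=
  match t with
  | Atom _ | Susp _ _ => 0
  | Abs _ u => (depth u).+1
  | App f us => (\max_(i < ar f) depth (us i)).+1
  end.

Lemma depth_pact p t : depth (pact p t) = depth t.
Proof.
elim: t => //= [a t -> //|f us IH]; congr _.+1; exact: eq_bigr.
Qed.

(** The abstraction rule of [sfix] descends into a renamed body, which is not a subterm.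
    Permutations preserve [depth], so induction on depth covers every [pact r t]. *)
Lemma term_pact_ind (P : term -> Prop) :
    (forall a, P (Atom var ar a)) -> (forall q X, P (Susp ar q X)) ->
    (forall a t, (forall r, P (pact r t)) -> P (Abs a t)) ->
    (forall f us, (forall i, P (us i)) -> P (@App _ _ _ _ f us)) ->
  forall t, P t.
Proof.
move=> PAtom PSusp PAbs PApp t; move: {2}(depth t).+1 (ltnSn (depth t)) => n.
elim: n t => // n IH [a|q X|a t|f us] //=; rewrite ltnS => lt_n.
  by apply: PAbs => r; apply: IH; rewrite depth_pact.
apply: PApp => i; apply: IH; apply: leq_ltn_trans lt_n.
exact: (leq_bigmax (F := fun i => depth (us i))).
Qed.

(* A recursive form of [fresh]: inverting [fresh D a (App us)] directly would
   need equality on [op] to be decidable. *)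
Fixpoint freshb D (a : atom) t : bool :=
  match t with
  | Atom b => a != b
  | Susp q X => D (fpinv q a) X
  | Abs b u => (a == b) || freshb D a u
  | App f us => [forall i, freshb D a (us i)]
  end.

Lemma freshP (G : fresh_ctx atom var) a t :
  reflect (fresh G a t) (freshb (fun b X => (b, X) \in G) a t).
Proof.
apply: (iffP idP) => [|Gat].
  elim: t => [b /eqP|q X|b t IH /=|f us IH /= /forallP us_a].
  - exact: fresh_atom.
  - exact: fresh_susp.
  - have [-> _|/eqP ab /IH] := eqVneq a b; first exact: fresh_abs.
    exact: fresh_abs_neq.
  - by apply: fresh_app => i; apply: IH.
elim: Gat => /= [b /eqP//|//|u|b u _ _ ->|f us _ IH].
- by rewrite eqxx.
- by rewrite orbT.
- exact/forallP.
Qed.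

(** At a suspension the atom tested is [fpinv q a], which is [a] itself or lies in [finsupp q]. *)
Lemma eq_freshb D E a t :
    (forall b X, b \in a |` atoms t -> X \in vars t -> D b X = E b X) ->
  freshb D a t = freshb E a t.
Proof.
elim: t => [b|q X|b t IH|f us IH] //= eqDE.
- apply: eqDE; rewrite ?inE //.
  case: (boolP (a \in finsupp q)) => [aq|/fpinv_out->]; last by rewrite eqxx.
  apply/orP; right; move: aq; rewrite !mem_finsupp fpinvKV => qa.
  by rewrite eq_sym fpinv_neq eq_sym.
- congr orb; apply: IH => c X ca; apply: eqDE.
  by move: ca; rewrite !inE => /orP[->//|->]; rewrite !orbT.
- apply: eq_forallb => i; apply: IH => c X ca Xus; apply: eqDE.
    by apply: (fsubsetP (fsetUS _ (atoms_arg us i))).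
  exact: (fsubsetP (vars_arg us i)).
Qed.

Lemma freshb_new D c t : c \notin atoms t -> (forall X, D c X) -> freshb D c t.
Proof.
move=> + Dc; elim: t => [b|q X|b t IH|f us IH] /=.
- by rewrite inE.
- by move=> /fpinv_out->.
- by rewrite !inE negb_or => /andP[_ /IH->]; rewrite orbT.
- move=> cus; apply/forallP => i; apply: IH; apply: contra cus.
  exact: (fsubsetP (atoms_arg us i)).
Qed.

(** [D] is not permuted, since a suspension pulls the atom back through its permutation before
    consulting [D]. *)
Lemma freshb_pact D p a t : freshb D a (pact p t) = freshb D (fpinv p a) t.
Proof.
elim: t => [b|q X|b t IH|f us IH] /=.
- by rewrite fpinv_neq.
- by rewrite fpinv_comp.
- by rewrite IH; congr orb; apply/negb_inj; rewrite fpinv_neq.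
- exact: eq_forallb.
Qed.

End Freshness.

(** * Strong judgements as freshness under admissibility *)

Section Translation.
Variables (atom var : choiceType) (op : Type) (ar : op -> nat).
Local Notation term := (term atom var ar).
Variable Y : fix_ctx atom var.
Implicit Types (cs : {fset atom}) (p q : fperm atom) (s t : term).

Definition admissible cs (b : atom) : pred var :=
  fun X => (b \in cs) || (b \in dom_perm Y X).

Lemma mem_to_fresh b X : ((b, X) \in to_fresh Y) = (b \in dom_perm Y X).
Proof.
apply/imfsetP/imfsetP => -[[[a c] Z]] /=; rewrite ?inE /=.
  by move=> aY [-> ->]; exists (a, c, Z); rewrite // !inE aY /=.
by move=> /andP[aY /eqP<-] ->; exists (a, c, Z).
Qed.

Lemma freshb_admissibleU cs c a t :
    c \notin atoms t -> a != c ->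
  freshb (admissible (c |` cs)) a t = freshb (admissible cs) a t.
Proof.
move=> ct ac; apply: eq_freshb => b X bt _; rewrite /admissible !inE.
by case: eqVneq bt => // ->; rewrite !inE (negbTE ct) eq_sym (negbTE ac).
Qed.

(** For [b = a] both sides hold: [a] becomes [c], which avoids [t] and is admissible for every
    variable. Otherwise the swap fixes [b], and adding [c] to [cs] has no effect at [b]. *)
Lemma freshb_swap_new cs a c b t :
    c \notin a |` atoms t -> b != c ->
  freshb (admissible (c |` cs)) b (pact (swap a c) t)
    = freshb (admissible cs) b (Abs a t).
Proof.
rewrite !inE negb_or => /andP[ca ct] bc; rewrite freshb_pact fpinv_swap swapE /=.
have [_|ba] := eqVneq b a; last by rewrite (negbTE bc) freshb_admissibleU.
by apply: freshb_new => // X; rewrite /admissible !inE eqxx.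
Qed.

Lemma sfix_freshb cs p t :
  sfix Y cs p t -> forall b, p b != b -> freshb (admissible cs) b t.
Proof.
elim=> {cs p t} [cs p a pa b|cs p q X sub b pb|cs p f us _ IH b pb|
                 cs c1 p a t c1new _ IH b pb] /=.
- by apply: contraNneq => ->; rewrite pa.
(* Since [p] moves [b], its conjugate in the premise moves [fpinv q b]. *)
- have /fsubsetP/(_ (fpinv q b)) := sub.
  rewrite !inE mem_finsupp !fpcompE fpinvKV fpinv_neq fpinvKV pb andbT /admissible.
  by case: (_ \in cs) => //= ->.
- by apply/forallP => i; apply: IH.
- have bc : b != c1.
    by apply: contraNneq c1new => <-; rewrite !inE mem_finsupp pb !orbT.
  rewrite -[X in is_true X]/(freshb (admissible cs) b (Abs a t)).
  rewrite -(@freshb_swap_new _ _ c1) //; first exact: IH.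
  by move: c1new; rewrite in_fsetU negb_or => /andP[].
Qed.

Hypothesis atom_infinite : forall S : {fset atom}, exists a, a \notin S.

Lemma freshb_sfix cs p t :
  (forall b, p b != b -> freshb (admissible cs) b t) -> sfix Y cs p t.
Proof.
elim/term_pact_ind: t cs p => [a|q X|a t IH|f us IH] cs p pt.
- by apply: sfix_atom; apply/eqP/negP => /negP /pt /=; rewrite eqxx.
(* If the conjugate moves [b], then [p] moves [q b], and [pt] is used there. *)
- apply: sfix_susp; apply/fsubsetP => b; rewrite !inE mem_finsupp !fpcompE fpinv_neq.
  by move=> /andP[bcs /pt]; rewrite /= fpinvK /admissible (negbTE bcs).
- have [c1 c1new] := atom_infinite (cs `|` ctx_atoms Y `|` finsupp p `|` (a |` atoms t)).
  apply: (sfix_abs c1new); apply: IH => b pb.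
  move: c1new; rewrite in_fsetU negb_or => /andP[c1p c1t].
  rewrite freshb_swap_new //; first exact: pt.
  apply: contraNneq c1p => <-.
  by rewrite !in_fsetU mem_finsupp pb !orbT.
- by apply: sfix_app => i; apply: IH => b /pt /= /forallP.
Qed.

(** The swap moves only [a] and [c]. The condition at [c] is automatic, as [c] avoids [t] and is
    admissible, so only the one at [a] remains. *)
Lemma sfix_swap_new cs a c t :
    c \notin a |` atoms t ->
  sfix Y (c |` cs) (swap a c) t <-> freshb (admissible cs) a t.
Proof.
rewrite !inE negb_or => /andP[ca ct].
have ac : a != c by rewrite eq_sym.
split=> [/sfix_freshb/(_ a)|a_t].
  by rewrite swapE eqxx freshb_admissibleU // eq_sym; apply.
apply: freshb_sfix => b; rewrite swapE.
have [-> _|ba] := eqVneq b a; first by rewrite freshb_admissibleU.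
have [-> _|] := eqVneq b c; last by rewrite eqxx.
by apply: freshb_new => // X; rewrite /admissible !inE eqxx.
Qed.

Lemma fresh_admissible cs (V : {fset var}) a t :
    vars t `<=` V ->
  fresh (to_fresh Y `|` cs `*` V) a t <-> freshb (admissible cs) a t.
Proof.
move=> tV; rewrite (rwP (freshP _ _ _)).
rewrite (@eq_freshb _ _ _ _ _ (admissible cs)) // => b X _ /(fsubsetP tV) XV.
by rewrite in_fsetU mem_to_fresh in_fsetM XV andbT orbC.
Qed.

(** A fixed [V] keeps the freshness context constant while the induction passes to subterms with
    fewer variables. *)
Lemma saeq_aeq cs (V : {fset var}) s t :
    saeq Y cs s t -> vars s `|` vars t `<=` V ->
  aeq (to_fresh Y `|` cs `*` V) s t.
Proof.
elim=> {s t} [a|p q X sub|f us vs _ IH|a s t _ IH|a b c1 s t ab _ IH c1new fixt];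
  rewrite fsubUset => /andP[sV tV].
- exact: aeq_atom.
- apply: aeq_susp => a /eqP pqa; rewrite in_fsetU mem_to_fresh in_fsetM.
  have -> : X \in V by apply: (fsubsetP sV); rewrite inE.
  have /fsubsetP/(_ a) := sub.
  rewrite in_fsetD mem_finsupp !fpcompE fpinv_neq pqa !andbT.
  by case: (_ \in cs) => [_|->]; rewrite ?orbT.
- apply: aeq_app => i; apply: IH; rewrite fsubUset.
  by rewrite (fsubset_trans (vars_arg us i) sV) (fsubset_trans (vars_arg vs i) tV).
- by apply: aeq_abs; apply: IH; rewrite fsubUset sV.
- apply: aeq_abs_neq => //; first by apply: IH; rewrite vars_pact fsubUset sV.
  apply/fresh_admissible => //; apply: iffLR (sfix_swap_new _ _) fixt.
  (* That [c1] differs from [a] comes from the left abstraction, that it avoids [t] from the right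
     one. *)
  by move: c1new; rewrite !inE !negb_or => /and3P[/and3P[_ -> _] _ ->].
Qed.

Lemma aeq_saeq cs (V : {fset var}) s t :
    aeq (to_fresh Y `|` cs `*` V) s t -> vars s `|` vars t `<=` V ->
  saeq Y cs s t.
Proof.
elim=> {s t} [a|p q X sub|f us vs _ IH|a s t _ IH|a b s t ab _ IH fresht];
  rewrite fsubUset => /andP[sV tV].
- exact: saeq_atom.
- apply: saeq_susp; apply/fsubsetP => a.
  rewrite in_fsetD mem_finsupp !fpcompE fpinv_neq => /andP[acs /eqP/sub].
  by rewrite in_fsetU mem_to_fresh in_fsetM (negbTE acs) orbF.
- apply: saeq_app => i; apply: IH; rewrite fsubUset.
  by rewrite (fsubset_trans (vars_arg us i) sV) (fsubset_trans (vars_arg vs i) tV).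
- by apply: saeq_abs; apply: IH; rewrite fsubUset sV.
- have [c1 c1new] :=
    atom_infinite (cs `|` ctx_atoms Y `|` (a |` atoms s) `|` (b |` atoms t)).
  apply: (saeq_abs_neq ab _ c1new).
    by apply: IH; rewrite vars_pact fsubUset sV.
  apply: iffRL (sfix_swap_new _ _) (iffLR (@fresh_admissible _ _ _ t tV) fresht).
  by move: c1new; rewrite !inE !negb_or => /and3P[/and3P[_ -> _] _ ->].
Qed.

End Translation.

Theorem theorem5p5 (atom var : choiceType)
    (atom_infinite : forall S : {fset atom}, exists a, a \notin S)
    (op : Type) (ar : op -> nat)
    (A cs0 cs : {fset atom}) (Y : fix_ctx atom var)
    (strongY : strong_fix_ctx A cs0 Y) (cs0_sub : cs0 `<=` cs) :
  (forall (a c1 : atom) (t : term atom var ar),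
      [disjoint cs & a |` atoms t] ->
      c1 \notin cs `|` ctx_atoms Y `|` (a |` atoms t) ->
      sfix Y (c1 |` cs) (swap a c1) t <-> fresh (to_fresh Y) a t) /\
  (forall s t : term atom var ar,
      saeq Y cs s t <->
      aeq (to_fresh Y `|` cs `*` (vars s `|` vars t)) s t).
Proof.
split=> [a c1 t cs_t c1new|s t]; last by split=> [/saeq_aeq|/aeq_saeq]; apply.
have c1t : c1 \notin a |` atoms t.
  by move: c1new; rewrite in_fsetU negb_or => /andP[].
rewrite sfix_swap_new // (rwP (freshP _ _ _)).
(* [cs] avoids [a] and the atoms of [t], the only atoms at which the two predicates have to
   agree. *)
rewrite (@eq_freshb _ _ _ _ (admissible Y cs) (fun b X => (b, X) \in to_fresh Y)) //.
move=> b X bt _; rewrite mem_to_fresh /admissible.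
by rewrite (negbTE (fdisjointP_sym cs_t _ bt)).
Qed.
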